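(* Define $$g(x)=1+\frac x4+x^2+\sum_{n\ge3}\frac{x^n}{n!},\qquad f(x)=g(x/2),$$ and write $f(x)=\sum_{n\ge0}a_nx^n$, $g(x)=\sum_{n\ge0}b_nx^n$. Then $f,g$ are entire, all coefficients $b_n$ of $g$ are positive, and the ratio sequence $a_n/b_n=2^{-n}$ is strictly completely monotone; yet $f/g$ is not completely monotone on any interval $(0,\varepsilon)$, $\varepsilon>0$. Hence the following question has a negative answer: if $f(x)=\sum_{n\ge0}a_nx^n$ and $g(x)=\sum_{n\ge0}b_nx^n$ converge on $(-r,r)$, with $b_n>0$ for all $n$, and the sequence $\{a_n/b_n\}_{n\ge0}$ is strictly completely monotone (respectively completely monotone), must $f/g$ be strictly completely monotone (respectively completely monotone) on $(0,r)$?
   Context: A real sequence $(c_n)_{n\ge0}$ is completely monotone if $\Delta^kc_n\ge0$ for all $n,k\ge0$, where $\Delta c_n=c_n-c_{n+1}$, and strictly completely monotone if all these inequalities are strict. A function $F$ on an open interval $(0,\varepsilon)$ is completely monotone there if $F\in C^\infty$ and $(-1)^nF^{(n)}(x)\ge0$ for all integers $n\ge0$ and all $x\in(0,\varepsilon)$; it is strictly completely monotone if all these inequalities are strict. *)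

(* Defs.v *)
(* Stdlib reals with Coquelicot. *)
From Stdlib Require Import Reals Factorial.
From Coquelicot Require Import Coquelicot.
Open Scope R_scope.

Definition Delta (c : nat -> R) : nat -> R := fun n => c n - c (S n).

Definition cm_seq (c : nat -> R) : Prop :=
  forall n k : nat, 0 <= Nat.iter k Delta c n.

Definition strict_cm_seq (c : nat -> R) : Prop :=
  forall n k : nat, 0 < Nat.iter k Delta c n.

(* [ex_derive_n F n x] only requires [Derive_n F (n-1)] to be differentiable at
   [x]; required for every [n] and every point of the open interval, it says
   that F is infinitely differentiable there. *)
Definition smooth_on (eps : R) (F : R -> R) : Prop :=
  forall (n : nat) (x : R), 0 < x < eps -> ex_derive_n F n x.

(* (Strict) complete monotonicity on the open interval (0, eps). *)
Definition cm_on (eps : R) (F : R -> R) : Prop :=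
  smooth_on eps F /\
  forall (n : nat) (x : R), 0 < x < eps -> 0 <= (-1) ^ n * Derive_n F n x.

Definition strict_cm_on (eps : R) (F : R -> R) : Prop :=
  smooth_on eps F /\
  forall (n : nat) (x : R), 0 < x < eps -> 0 < (-1) ^ n * Derive_n F n x.

(* A function of a real variable is entire when it is the restriction to the
   real line of a function that is complex differentiable on all of C. *)
Definition entire (F : R -> R) : Prop :=
  exists G : C -> C,
    (forall z : C, @ex_derive C_AbsRing C_NormedModule G z) /\
    (forall x : R, G (RtoC x) = RtoC (F x)).

(* The sum over n >= 3 is reindexed to start at 0. *)
Definition g_ex (x : R) : R :=
  1 + x / 4 + x ^ 2 + Series (fun n : nat => x ^ (n + 3) / INR (fact (n + 3))).

Definition f_ex (x : R) : R := g_ex (x / 2).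

Definition expands_on (r : R) (F : R -> R) (c : nat -> R) : Prop :=
  forall x : R, - r < x < r -> is_pseries c x (F x).

Definition strict_cm_question : Prop :=
  forall (r : R) (F G : R -> R) (a b : nat -> R),
    0 < r -> expands_on r F a -> expands_on r G b ->
    (forall n : nat, 0 < b n) ->
    strict_cm_seq (fun n => a n / b n) ->
    strict_cm_on r (fun x => F x / G x).

Definition cm_question : Prop :=
  forall (r : R) (F G : R -> R) (a b : nat -> R),
    0 < r -> expands_on r F a -> expands_on r G b ->
    (forall n : nat, 0 < b n) ->
    cm_seq (fun n => a n / b n) ->
    cm_on r (fun x => F x / G x).

(* Main.v *)
Require Import Defs.
From Stdlib Require Import Reals Factorial Lra Lia.
From Coquelicot Require Import Coquelicot.
Open Scope R_scope.

(** Only the coefficients of x and x^2 of g differ from those of exp, so that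
    g(x) = e^x - 3x/4 + x^2/2. This closed form makes everything computable.

    The quotient f/g fails to be convex near 0, hence is not completely
    monotone there: from f = 1 + x/8 + x^2/4 + ... and
    g = 1 + x/4 + x^2 + ... one gets
    f/g = 1 - x/8 - (23/32) x^2 + ..., whose second derivative at 0 is -23/16.
    Concretely, the second derivative of f/g is [numer / g^3]
    ([quotient_second_derivative]); g is positive on the whole line and
    [numer], a continuous function, is -23/16 at 0, so it stays negative on a
    neighbourhood of 0 ([numer_neg_near_0]). The ratio of the coefficients,
    2^(-n), is nevertheless strictly completely monotone, because its k-th
    difference at n is 2^(-n-k) ([iter_Delta_half]). Taking r = 1, the pair
    (f, g) therefore refutes both forms of the question.

    Entireness is read off from the closed form, with e^z defined as
    e^a (cos b + i sin b) for z = a + ib. Instead of combining rules for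
    complex derivatives, one bounds the first-order remainder of a function
    by K |h|^2 for |h| <= 1 ([quad_rem]), which implies complex
    differentiability. By e^(z+h) = e^z e^h, the bound for the exponential
    reduces to the one at 0 ([cexp_bound2]), and this follows from real
    mean-value estimates for exp, sin and cos. *)

(** * Power series expansions *)

Lemma g_tail (x : R) :
  is_series (fun n : nat => x ^ (n + 3) / INR (fact (n + 3)))
    (exp x - 1 - x - x ^ 2 / 2).
Proof.
  apply is_series_ext with
    (fun n : nat => (fun k => / INR (fact k) * x ^ k) (3 + n)%nat).
  { intros n. rewrite (Nat.add_comm n 3). unfold Rdiv. apply Rmult_comm. }
  apply (is_series_incr_n (fun k => / INR (fact k) * x ^ k) 3); [lia |].
  assert (H := proj1 (is_pseries_R _ _ _) (is_exp_Reals x)).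
  replace (plus _ _) with (exp x); [exact H |].
  simpl Init.Nat.pred. rewrite !sum_Sn, sum_O.
  unfold plus; simpl. field.
Qed.

Lemma g_ex_closed (x : R) : g_ex x = exp x - 3 / 4 * x + x ^ 2 / 2.
Proof.
  unfold g_ex. rewrite (is_series_unique _ _ (g_tail x)). field.
Qed.

Definition g_coef (n : nat) : R :=
  match n with
  | 0%nat => 1
  | 1%nat => / 4
  | 2%nat => 1
  | _ => / INR (fact n)
  end.

Definition f_coef (n : nat) : R := g_coef n * / 2 ^ n.

Lemma g_coef_pos (n : nat) : 0 < g_coef n.
Proof.
  destruct n as [|[|[|n]]]; cbn [g_coef]; try lra.
  apply Rinv_0_lt_compat, INR_fact_lt_0.
Qed.

Lemma g_expansion (x : R) : is_pseries g_coef x (g_ex x).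
Proof.
  apply is_pseries_R, (is_series_decr_n _ 3 (g_ex x)); [lia |].
  replace (plus _ _) with (exp x - 1 - x - x ^ 2 / 2).
  - apply is_series_ext with (2 := g_tail x).
    intros n. rewrite (Nat.add_comm n 3). apply Rmult_comm.
  - rewrite g_ex_closed. simpl Init.Nat.pred. rewrite !sum_Sn, sum_O.
    unfold plus, opp; simpl. field.
Qed.

Lemma f_expansion (x : R) : is_pseries f_coef x (f_ex x).
Proof.
  apply is_pseries_R.
  apply is_series_ext with (2 := proj1 (is_pseries_R _ _ _) (g_expansion (x / 2))).
  intros n. unfold f_coef, Rdiv.
  rewrite Rpow_mult_distr, pow_inv. simpl. ring.
Qed.

Lemma coef_ratio (n : nat) : f_coef n / g_coef n = / 2 ^ n.
Proof.
  unfold f_coef. field. split; [apply pow_nonzero; lra |].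
  apply Rgt_not_eq, g_coef_pos.
Qed.

(** Halving: 2^(-m) - 2^(-m-1) = 2^(-m-1), so a difference is a shift. *)
Lemma iter_Delta_half (c : nat -> R) :
  (forall n, c n = / 2 ^ n) ->
  forall k n, Nat.iter k Defs.Delta c n = / 2 ^ (n + k).
Proof.
  intros Hc k. induction k as [|k IH]; intros n.
  - rewrite Nat.add_0_r. apply Hc.
  - simpl. unfold Defs.Delta. rewrite !IH. rewrite Nat.add_succ_r. simpl.
    field. apply pow_nonzero; lra.
Qed.

Lemma ratio_strict_cm : strict_cm_seq (fun n => f_coef n / g_coef n).
Proof.
  intros n k. rewrite (iter_Delta_half _ coef_ratio).
  apply Rinv_0_lt_compat, pow_lt. lra.
Qed.

(** * Quadratic remainder of the complex exponential *)

(** Applied to p' first and then to p, this turns a bound on p'' into a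
    second-order bound on p. Derivatives are controlled on the symmetric
    interval |t| <= |b| so that the sign of b need not be discussed. *)
Lemma mvt_bound (p dp : R -> R) (b M : R) :
  (forall t, is_derive p t (dp t)) ->
  (forall t, Rabs t <= Rabs b -> Rabs (dp t) <= M) ->
  Rabs (p b - p 0) <= M * Rabs b.
Proof.
  intros Hd HM.
  destruct (MVT_gen p 0 b dp) as [c [Hc ->]].
  - intros; apply Hd.
  - intros t _. apply continuity_pt_filterlim.
    apply (ex_derive_continuous (V := R_NormedModule)). eexists; apply Hd.
  - rewrite Rminus_0_r, Rabs_mult.
    apply Rmult_le_compat_r; [apply Rabs_pos |]. apply HM.
    revert Hc. unfold Rmin, Rmax, Rabs.
    destruct (Rle_dec 0 b), (Rcase_abs c), (Rcase_abs b); lra.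
Qed.

Lemma sin_bound1 (b : R) : Rabs (sin b) <= Rabs b.
Proof.
  rewrite <- (Rminus_0_r (sin b)), <- sin_0, <- (Rmult_1_l (Rabs b)).
  apply (mvt_bound sin cos).
  - intros t. apply is_derive_Reals, derivable_pt_lim_sin.
  - intros t _. apply Rabs_le, COS_bound.
Qed.

Lemma cos_bound2 (b : R) : Rabs (cos b - 1) <= Rabs b * Rabs b.
Proof.
  rewrite <- cos_0.
  apply (mvt_bound cos (fun t => - sin t)).
  - intros t. apply is_derive_Reals, derivable_pt_lim_cos.
  - intros t Ht. rewrite Rabs_Ropp.
    eapply Rle_trans; [apply sin_bound1 | exact Ht].
Qed.

Lemma sin_bound2 (b : R) : Rabs b <= 1 -> Rabs (sin b - b) <= Rabs b * Rabs b.
Proof.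
  intros Hb.
  replace (sin b - b) with ((sin b - b) - (sin 0 - 0)) by (rewrite sin_0; ring).
  apply (mvt_bound (fun t => sin t - t) (fun t => cos t - 1)).
  - intros t. auto_derive; [easy | ring].
  - intros t Ht. eapply Rle_trans; [apply cos_bound2 |].
    assert (H := Rabs_pos t). nra.
Qed.

Lemma exp_bound1 (a : R) : Rabs a <= 1 -> Rabs (exp a - 1) <= 3 * Rabs a.
Proof.
  intros Ha. rewrite <- exp_0.
  apply (mvt_bound exp exp).
  - intros t. apply is_derive_Reals, derivable_pt_lim_exp.
  - intros t Ht. rewrite Rabs_pos_eq by (left; apply exp_pos).
    apply Rle_trans with (exp 1); [| apply exp_le_3].
    assert (H := Rle_abs t).
    destruct (Req_dec t 1) as [-> | Hn]; [lra |].
    left. apply exp_increasing. lra.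
Qed.

Lemma exp_bound2 (a : R) :
  Rabs a <= 1 -> Rabs (exp a - 1 - a) <= 3 * Rabs a * Rabs a.
Proof.
  intros Ha.
  replace (exp a - 1 - a) with ((exp a - 1 - a) - (exp 0 - 1 - 0))
    by (rewrite exp_0; ring).
  apply (mvt_bound (fun t => exp t - 1 - t) (fun t => exp t - 1)).
  - intros t. auto_derive; [easy | ring].
  - intros t Ht. eapply Rle_trans; [apply exp_bound1; lra |]. lra.
Qed.

Definition cexp (z : C) : C := (exp (Re z) * cos (Im z), exp (Re z) * sin (Im z)).

Lemma cexp_plus (z w : C) : cexp (z + w) = (cexp z * cexp w)%C.
Proof.
  destruct z as [a b], w as [c d]. unfold cexp, Cplus, Cmult, Re, Im. simpl.
  rewrite exp_plus, cos_plus, sin_plus. f_equal; ring.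
Qed.

Lemma cexp_real (x : R) : cexp (RtoC x) = RtoC (exp x).
Proof.
  unfold cexp, RtoC, Re, Im. simpl. rewrite cos_0, sin_0. f_equal; ring.
Qed.

Lemma Cmod_le_parts (a b : R) : Cmod (a, b) <= Rabs a + Rabs b.
Proof.
  replace ((a, b) : C) with (RtoC a + Ci * RtoC b)%C
    by (unfold RtoC, Ci, Cplus, Cmult; simpl; f_equal; ring).
  eapply Rle_trans; [apply Cmod_triangle |].
  rewrite Cmod_mult, Cmod_Ci, !Cmod_R. lra.
Qed.

(** With h = a + ib, the real part of e^h - 1 - h is
    (e^a - 1 - a) cos b + (1 + a)(cos b - 1) and its imaginary part is
    (e^a - 1) sin b + (sin b - b). The four terms are at most 3, 2, 3 and 1
    times |h|^2, hence the constant 9. *)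
Lemma cexp_bound2 (h : C) :
  Cmod h <= 1 -> Cmod (cexp h - 1 - h) <= 9 * Cmod h ^ 2.
Proof.
  destruct h as [a b]. intros Hh.
  assert (Hm := Rmax_Cmod (a, b)). cbn [fst snd] in Hm.
  assert (Ha := Rle_trans _ _ _ (Rmax_l _ _) Hm).
  assert (Hb := Rle_trans _ _ _ (Rmax_r _ _) Hm). clear Hm.
  set (m := Cmod (a, b)) in *.
  replace ((cexp (a, b) - 1 - (a, b))%C) with
    ((exp a - 1 - a) * cos b + (1 + a) * (cos b - 1),
     ((exp a - 1) * sin b + (sin b - b)) : R)
    by (unfold cexp, Cminus, Cplus, Copp, RtoC, Re, Im; simpl; f_equal; ring).
  eapply Rle_trans; [apply Cmod_le_parts |].
  assert (E1 := exp_bound1 a ltac:(lra)).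
  assert (E2 := exp_bound2 a ltac:(lra)).
  assert (S1 := sin_bound1 b).
  assert (S2 := sin_bound2 b ltac:(lra)).
  assert (C2 := cos_bound2 b).
  assert (C1 : Rabs (cos b) <= 1) by apply Rabs_le, COS_bound.
  assert (A1 : Rabs (1 + a) <= 2).
  { eapply Rle_trans; [apply Rabs_triang |]. rewrite Rabs_R1. lra. }
  assert (Pa := Rabs_pos a). assert (Pb := Rabs_pos b).
  assert (Haa : Rabs a * Rabs a <= m * m) by nra.
  assert (Hbb : Rabs b * Rabs b <= m * m) by nra.
  assert (Hab : Rabs a * Rabs b <= m * m) by nra.
  (* The four terms are compared with m^2 one by one. *)
  assert (T1 : Rabs ((exp a - 1 - a) * cos b) <= 3 * (m * m)).
  { rewrite Rabs_mult. assert (H := Rabs_pos (cos b)).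
    assert (H' := Rabs_pos (exp a - 1 - a)). nra. }
  assert (T2 : Rabs ((1 + a) * (cos b - 1)) <= 2 * (m * m)).
  { rewrite Rabs_mult. apply Rmult_le_compat; try apply Rabs_pos; lra. }
  assert (T3 : Rabs ((exp a - 1) * sin b) <= 3 * (m * m)).
  { rewrite Rabs_mult.
    apply Rle_trans with ((3 * Rabs a) * Rabs b);
      [apply Rmult_le_compat; try apply Rabs_pos; lra | lra]. }
  assert (U1 := Rabs_triang ((exp a - 1 - a) * cos b) ((1 + a) * (cos b - 1))).
  assert (U2 := Rabs_triang ((exp a - 1) * sin b) (sin b - b)).
  assert (0 <= m * m) by nra.
  replace (m ^ 2) with (m * m) by ring. lra.
Qed.

(** * Complex differentiability *)

(** A quantitative form of G'(z) = l. *)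
Definition quad_rem (G : C -> C) (z l : C) (K : R) : Prop :=
  forall h : C, Cmod h <= 1 ->
    Cmod (G (z + h) - G z - h * l)%C <= K * Cmod h ^ 2.

(** The remainder is at most e |h| as soon as |h| <= min(1, e / K); K is
    first raised to at least 1 so that the quotient makes sense. *)
Lemma quad_rem_is_derive (G : C -> C) (z l : C) (K : R) :
  quad_rem G z l K -> @is_derive C_AbsRing C_NormedModule G z l.
Proof.
  intros HG. split; [apply is_linear_scal_l |].
  intros x Hx.
  apply (is_filter_lim_locally_unique (V := AbsRing_NormedModule C_AbsRing)) in Hx. subst x.
  intros eps.
  set (K' := Rmax K 1).
  assert (HK : 1 <= K' /\ K <= K') by (split; [apply Rmax_r | apply Rmax_l]).
  assert (Hd : 0 < Rmin 1 (eps / K')).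
  { apply Rmin_pos; [lra |]. apply Rdiv_lt_0_compat; [apply cond_pos | lra]. }
  exists (mkposreal _ Hd). intros y Hy. change C in (type of y).
  (* The norms and balls on both sides are the modulus, by conversion. *)
  change (Cmod (y - z)%C < Rmin 1 (eps / K')) in Hy.
  change (Cmod (G y - G z - (y - z) * l)%C <= eps * Cmod (y - z)%C).
  assert (H1 := Rlt_le_trans _ _ _ Hy (Rmin_l _ _)).
  assert (H2 := Rlt_le_trans _ _ _ Hy (Rmin_r _ _)).
  assert (HB := HG (y - z)%C (Rlt_le _ _ H1)).
  replace (z + (y - z))%C with y in HB by ring.
  eapply Rle_trans; [exact HB |].
  assert (P := Cmod_ge_0 (y - z)). set (m := Cmod (y - z)) in *.
  assert (K' * m <= eps).
  { apply Rmult_lt_compat_l with (r := K') in H2; [| lra].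
    replace (K' * (eps / K')) with (pos eps) in H2 by (field; lra). lra. }
  nra.
Qed.

Definition g_complex (z : C) : C := (cexp z - RtoC (3 / 4) * z + RtoC (/ 2) * (z * z))%C.

(** The remainder is e^z (e^h - 1 - h) + h^2/2. *)
Lemma g_complex_rem (z : C) :
  quad_rem g_complex z (cexp z - RtoC (3 / 4) + z) (9 * Cmod (cexp z) + / 2).
Proof.
  intros h Hh. unfold g_complex. rewrite cexp_plus.
  match goal with |- Cmod ?t <= _ => replace t with
    (cexp z * (cexp h - 1 - h) + RtoC (/ 2) * (h * h))%C end.
  - eapply Rle_trans; [apply Cmod_triangle |].
    rewrite !Cmod_mult, Cmod_R, (Rabs_pos_eq (/ 2)) by lra.
    assert (H := cexp_bound2 h Hh). assert (P := Cmod_ge_0 (cexp z)). nra.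
  (* The ring tactic treats 1/2 as an atom, so the relation 1/2 + 1/2 = 1
     has to be applied by hand. *)
  - replace (RtoC (/ 2) * (h * h))%C with
      (RtoC (/ 2) * ((z + h) * (z + h)) - RtoC (/ 2) * (z * z)
       - (RtoC (/ 2) + RtoC (/ 2)) * (z * h))%C by ring.
    replace (RtoC (/ 2) + RtoC (/ 2))%C with (RtoC 1)
      by (rewrite <- RtoC_plus; f_equal; field).
    ring.
Qed.

Lemma quad_rem_half (G : C -> C) (z l : C) (K : R) :
  quad_rem G (RtoC (/ 2) * z) l K ->
  quad_rem (fun w => G (RtoC (/ 2) * w)%C) z (RtoC (/ 2) * l) (K * / 4).
Proof.
  intros HG h Hh. assert (P := Cmod_ge_0 h).
  assert (E : Cmod (RtoC (/ 2) * h) = / 2 * Cmod h).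
  { rewrite Cmod_mult, Cmod_R, Rabs_pos_eq by lra. reflexivity. }
  assert (H := HG (RtoC (/ 2) * h)%C ltac:(lra)).
  rewrite E in H.
  replace (RtoC (/ 2) * (z + h))%C with (RtoC (/ 2) * z + RtoC (/ 2) * h)%C by ring.
  replace (h * (RtoC (/ 2) * l))%C with (RtoC (/ 2) * h * l)%C by ring.
  eapply Rle_trans; [exact H |]. right. field.
Qed.

Lemma g_complex_real (x : R) : g_complex (RtoC x) = RtoC (g_ex x).
Proof.
  unfold g_complex. rewrite cexp_real, g_ex_closed, <- !RtoC_mult, <- RtoC_minus, <- RtoC_plus.
  f_equal. field.
Qed.

Lemma entire_g : entire g_ex.
Proof.
  exists g_complex. split; [| exact g_complex_real].
  intros z. eexists. exact (quad_rem_is_derive _ _ _ _ (g_complex_rem z)).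
Qed.

Lemma entire_f : entire f_ex.
Proof.
  exists (fun w => g_complex (RtoC (/ 2) * w)%C). split.
  - intros z. eexists.
    exact (quad_rem_is_derive _ _ _ _ (quad_rem_half _ _ _ _ (g_complex_rem _))).
  - intros x. rewrite <- RtoC_mult, g_complex_real. unfold f_ex. do 2 f_equal. field.
Qed.

(** * Failure of convexity near 0 *)

Definition g' (x : R) : R := exp x - 3 / 4 + x.
Definition g'' (x : R) : R := exp x + 1.

(** By e^x >= 1 + x, g(x) is at least 1 + x/4 + x^2/2, which has negative
    discriminant. *)
Lemma g_ex_pos (x : R) : 0 < g_ex x.
Proof.
  rewrite g_ex_closed. assert (H := exp_ineq1_le x). nra.
Qed.

Lemma is_derive_g (x : R) : is_derive g_ex x (g' x).
Proof.
  apply is_derive_ext with (fun x => exp x - 3 / 4 * x + x ^ 2 / 2).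
  - intros t. symmetry. apply g_ex_closed.
  - unfold g'. auto_derive; [easy | field].
Qed.

Lemma is_derive_g' (x : R) : is_derive g' x (g'' x).
Proof. unfold g', g''. auto_derive; [easy | field]. Qed.

Lemma is_derive_f (x : R) : is_derive f_ex x (g' (x / 2) / 2).
Proof.
  unfold f_ex.
  evar_last.
  - apply (is_derive_comp g_ex (fun t => t / 2) x (g' (x / 2)) (/ 2)); [apply is_derive_g |].
    auto_derive; [easy | field].
  - unfold scal; simpl; unfold mult; simpl. field.
Qed.

Lemma is_derive_f' (x : R) :
  is_derive (fun t => g' (t / 2) / 2) x (g'' (x / 2) / 4).
Proof. unfold g', g''. auto_derive; [easy | unfold Rdiv; field]. Qed.

(** The numerator of (f/g)'' over g^3, that is (f'' g - f g'') g
    - 2 g' (f' g - f g'), where f'(x) = g'(x/2)/2 and f''(x) = g''(x/2)/4. *)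
Definition numer (x : R) : R :=
  (g'' (x / 2) / 4 * g_ex x - f_ex x * g'' x) * g_ex x
  - 2 * g' x * (g' (x / 2) / 2 * g_ex x - f_ex x * g' x).

Lemma quotient_second_derivative (x : R) :
  Derive_n (fun t => f_ex t / g_ex t) 2 x = numer x / g_ex x ^ 3.
Proof.
  assert (Hg : forall t, g_ex t <> 0) by (intros t; apply Rgt_not_eq, g_ex_pos).
  simpl.
  rewrite (Derive_ext _ (fun t => (g' (t / 2) / 2 * g_ex t - f_ex t * g' t)
                                   / g_ex t ^ 2)).
  - apply is_derive_unique. evar_last.
    + apply is_derive_div.
      * apply (is_derive_minus (V := R_NormedModule));
          apply (is_derive_mult (K := R_AbsRing)); try apply Rmult_comm.
        -- apply is_derive_f'.
        -- apply is_derive_g.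
        -- apply is_derive_f.
        -- apply is_derive_g'.
      * apply is_derive_pow, is_derive_g.
      * apply pow_nonzero, Hg.
    + unfold numer, minus, plus, opp, mult; simpl. field. apply Hg.
  - intros t. apply is_derive_unique. evar_last.
    + apply is_derive_div; [apply is_derive_f | apply is_derive_g | apply Hg].
    + field. apply Hg.
Qed.

Lemma numer_neg_near_0 : exists d : posreal, forall x, Rabs x < d -> numer x < 0.
Proof.
  assert (HN : continuous numer 0).
  { apply (ex_derive_continuous (V := R_NormedModule)).
    (* Spelled out with exp, numer is differentiable by computation. *)
    apply ex_derive_ext with (fun x =>
      let e := exp x in let e2 := exp (x / 2) in
      let g := e - 3 / 4 * x + x ^ 2 / 2 in
      let f := e2 - 3 / 4 * (x / 2) + (x / 2) ^ 2 / 2 in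
      ((e2 + 1) / 4 * g - f * (e + 1)) * g
      - 2 * (e - 3 / 4 + x) * ((e2 - 3 / 4 + x / 2) / 2 * g - f * (e - 3 / 4 + x))).
    - intros t. unfold numer, f_ex. rewrite !g_ex_closed. reflexivity.
    - cbv zeta. auto_derive. easy. }
  assert (H0 : numer 0 < 0).
  { unfold numer, f_ex, g', g''. rewrite !g_ex_closed.
    replace (0 / 2) with 0 by field. rewrite exp_0. lra. }
  destruct (HN (fun y => y < 0)) as [d Hd]; [apply (open_lt 0 _ H0) |].
  exists d. intros x Hx. apply Hd.
  change (Rabs (x - 0) < d). rewrite Rminus_0_r. exact Hx.
Qed.

Lemma quotient_not_cm (eps : R) :
  0 < eps -> ~ cm_on eps (fun x => f_ex x / g_ex x).
Proof.
  intros Heps [_ Hcm]. destruct numer_neg_near_0 as [d Hd].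
  assert (Hm : 0 < Rmin eps d) by (apply Rmin_pos; [exact Heps | apply cond_pos]).
  set (x := Rmin eps d / 2).
  assert (He := Rmin_l eps d). assert (Hx := Rmin_r eps d).
  assert (Hpos : 0 < x) by (unfold x; lra).
  assert (HD := Hcm 2%nat x ltac:(unfold x; lra)).
  rewrite quotient_second_derivative in HD.
  assert (HN : numer x < 0) by (apply Hd; rewrite Rabs_pos_eq; unfold x in *; lra).
  assert (Hg : 0 < / g_ex x ^ 3) by apply Rinv_0_lt_compat, pow_lt, g_ex_pos.
  unfold Rdiv in HD. nra.
Qed.

Theorem mainTheorem11 :
  (exists a b : nat -> R,
     (forall x : R, is_pseries a x (f_ex x)) /\
     (forall x : R, is_pseries b x (g_ex x)) /\
     entire f_ex /\ entire g_ex /\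
     (forall n : nat, 0 < b n) /\
     (forall n : nat, a n / b n = / 2 ^ n) /\
     strict_cm_seq (fun n : nat => a n / b n)) /\
  (forall eps : R, 0 < eps -> ~ cm_on eps (fun x : R => f_ex x / g_ex x)) /\
  ~ strict_cm_question /\
  ~ cm_question.
Proof.
  split; [| split; [exact quotient_not_cm | split; intros Q]].
  - exists f_coef, g_coef.
    repeat split; [ exact f_expansion | exact g_expansion | exact entire_f
      | exact entire_g | exact g_coef_pos | exact coef_ratio | exact ratio_strict_cm ].
  - apply (quotient_not_cm 1 Rlt_0_1).
    destruct (Q 1 f_ex g_ex f_coef g_coef Rlt_0_1
      (fun x _ => f_expansion x) (fun x _ => g_expansion x) g_coef_pos
      ratio_strict_cm) as [Hs Hd].
    split; [exact Hs |]. intros n x Hx. left. exact (Hd n x Hx).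
  - apply (quotient_not_cm 1 Rlt_0_1).
    apply (Q 1 f_ex g_ex f_coef g_coef Rlt_0_1
      (fun x _ => f_expansion x) (fun x _ => g_expansion x) g_coef_pos).
    intros n k. left. apply ratio_strict_cm.
Qed.
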